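(* As formal power series in $q$ with coefficients Laurent polynomials in $z$, \[ (1-z)(1-z^{-1})\,\overline{S}_1(z,q)=\sum_{n=0}^\infty\sum_{m=-\infty}^\infty\frac{\overline{N}(m,n)}{2}z^mq^n-\frac{(-q;q)_\infty}{(q;q)_\infty}\Bigl(\frac12+\sum_{n=1}^\infty\frac{(1-z)(1-z^{-1})(-1)^nq^n}{(1-zq^n)(1-z^{-1}q^n)}\Bigr). \]
   Context: Notation: $(a;q)_\infty=\prod_{k\ge0}(1-aq^k)$, $(a;q)_n=(a;q)_\infty/(aq^n;q)_\infty$. Define \[ \overline{S}_1(z,q)=\sum_{n=0}^\infty\frac{q^{2n+1}(-q^{2n+2};q)_\infty(q^{2n+2};q)_\infty}{(zq^{2n+1};q)_\infty(z^{-1}q^{2n+1};q)_\infty}. \] $\overline{N}(m,n)$ (number of overpartitions of $n$ with Dyson rank $m$) is defined by \[ \sum_{n\ge0}\sum_{m}\overline{N}(m,n)z^mq^n=\sum_{n=0}^\infty\frac{(-1;q)_n\,q^{n(n+1)/2}}{(zq;q)_n(z^{-1}q;q)_n}. \] *)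

(* Defs.v *)
(* Formal power series in q over a field K, encoded as
   coefficient functions nat -> K; infinite sums/products are q-adic limits
   (coefficientwise eventual values). *)
From HB Require Import structures.
From mathcomp Require Import all_boot all_order all_algebra.
From Stdlib Require Import ClassicalEpsilon.
Set Implicit Arguments. Unset Strict Implicit. Unset Printing Implicit Defensive.
Import GRing.Theory.
Local Open Scope ring_scope.

Section Series.
Variable K : fieldType.

Definition series := nat -> K.

Definition sC (c : K) : series := fun n => if n == 0%N then c else 0.
Definition sX : series := fun n => if n == 1%N then 1 else 0.
Definition sadd (f g : series) : series := fun n => f n + g n.
Definition sopp (f : series) : series := fun n => - f n.
Definition ssub (f g : series) : series := sadd f (sopp g).
Definition sscale (c : K) (f : series) : series := fun n => c * f n.
Definition smul (f g : series) : series :=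
  fun n => \sum_(i < n.+1) f i * g (n - i)%N.
Fixpoint spow (f : series) (k : nat) : series :=
  match k with 0 => sC 1 | k'.+1 => smul f (spow f k') end.

Fixpoint ssum_fin (F : nat -> series) (J : nat) : series :=
  match J with 0 => sC 0 | J'.+1 => sadd (ssum_fin F J') (F J') end.
Fixpoint sprod_fin (F : nat -> series) (J : nat) : series :=
  match J with 0 => sC 1 | J'.+1 => smul (sprod_fin F J') (F J') end.

(* q-adic limit: the n-th coefficient is the eventual value of the n-th
   coefficients of the sequence (when it exists) *)
Definition slim (s : nat -> series) : series :=
  fun n => epsilon (inhabits 0)
             (fun a : K => exists J, forall j, (J <= j)%N -> s j n = a).

Definition ssum (F : nat -> series) : series := slim (ssum_fin F).
Definition sprod (F : nat -> series) : series := slim (sprod_fin F).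

(* 1/(1-x) for x with zero constant term *)
Definition sgeom (x : series) : series := ssum (spow x).
(* inverse of a series with nonzero constant term s0: s = s0 (1 - y) *)
Definition sinv (s : series) : series :=
  sscale (s 0%N)^-1 (sgeom (ssub (sC 1) (sscale (s 0%N)^-1 s))).
Definition sdiv (f g : series) : series := smul f (sinv g).

Definition qpoch (a : series) (n : nat) : series :=
  sprod_fin (fun k => ssub (sC 1) (smul a (spow sX k))) n.
Definition qpoch_inf (a : series) : series :=
  sprod (fun k => ssub (sC 1) (smul a (spow sX k))).

Definition Sbar1 (z : K) : series :=
  ssum (fun n =>
    sdiv (smul (smul (spow sX (2 * n + 1)) (qpoch_inf (sopp (spow sX (2 * n + 2)))))
               (qpoch_inf (spow sX (2 * n + 2))))
         (smul (qpoch_inf (sscale z (spow sX (2 * n + 1))))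
               (qpoch_inf (sscale z^-1 (spow sX (2 * n + 1)))))).

(* sum_{n,m} Nbar(m,n) z^m q^n, by its defining generating function *)
Definition Nbar_gf (z : K) : series :=
  ssum (fun n =>
    sdiv (smul (qpoch (sC (-1)) n) (spow sX (n * n.+1)./2))
         (smul (qpoch (sscale z sX) n) (qpoch (sscale z^-1 sX) n))).

End Series.

(* Main.v *)
(* Write (a) for (a; q)_oo and D = (zq) (q/z).  Since
   (1 - z) (1 - 1/z) / ((zq^m) (q^m/z)) = (z)_m (1/z)_m / D, the left-hand
   side times 2D is the sum over odd m of 2 t_m, that is A - B with A = sum t_m and
   B = sum (-1)^m t_m, where t_m = q^m (z)_m (1/z)_m (q^(m+1)) (-q^(m+1)) and m
   may start at 0.
   - A is the sum of a 2phi1 with argument q.  A contiguous relation shifting all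
     its parameters by q, iterated infinitely often, rewrites A as D times the
     overpartition rank generating function.
   - B is a q-Gauss sum, again evaluated by iterating a contiguous relation:
     B = (q) (-zq) (-q/z) / (-q).
   - The theta quotient (-zq) (-q/z) / D is expanded into a Lambert series by
     passing to the limit in the partial fraction expansion of its N-factor
     truncation, which is proved by induction on N.
   Contiguous relations are proved by telescoping; limits are q-adic. *)
From HB Require Import structures.
Require Import Defs.
From mathcomp Require Import all_boot all_order all_algebra.
From mathcomp Require Import boolp ring zify.
Import GRing.Theory.
Local Open Scope ring_scope.

(** * The commutative ring of formal power series *)

Section SeriesRing.
Set Implicit Arguments. Unset Strict Implicit. Unset Printing Implicit Defensive.
Variable K : fieldType.
Implicit Types f g h : series K.

HB.instance Definition _ := gen_eqMixin (series K).
HB.instance Definition _ := gen_choiceMixin (series K).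

Fact saddA : associative (@sadd K).
Proof. by move=> f g h; apply: funext => n; rewrite /sadd addrA. Qed.
Fact saddC : commutative (@sadd K).
Proof. by move=> f g; apply: funext => n; rewrite /sadd addrC. Qed.
Fact sadd0 : left_id (sC 0) (@sadd K).
Proof. by move=> f; apply: funext => n; rewrite /sadd /sC if_same add0r. Qed.
Fact saddN : left_inverse (sC 0) (@sopp K) (@sadd K).
Proof.
by move=> f; apply: funext => n; rewrite /sadd /sopp /sC if_same addNr.
Qed.

HB.instance Definition _ :=
  GRing.isZmodule.Build (series K) saddA saddC sadd0 saddN.

(** A coefficient of a product involves only finitely many coefficients of the factors, so the ring
    laws can be borrowed from polynomials. *)
Lemma smul_poly N f g n : (n < N)%N ->
  smul f g n = ((\poly_(i < N) f i) * (\poly_(i < N) g i))`_n.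
Proof.
move=> nN; rewrite coefM /smul; apply: eq_bigr => i _.
have := ltn_ord i; rewrite ltnS => iN.
by rewrite !coef_poly (leq_ltn_trans iN nN) (leq_ltn_trans (leq_subr i n) nN).
Qed.

Fact smulC : commutative (@smul K).
Proof.
by move=> f g; apply: funext => n; rewrite !(@smul_poly n.+1) // mulrC.
Qed.
Fact smulA : associative (@smul K).
Proof.
move=> f g h; apply: funext => n; rewrite /smul.
transitivity (\sum_(i < n.+1) (\poly_(i < n.+1) f i)`_i *
   ((\poly_(i < n.+1) g i) * (\poly_(i < n.+1) h i))`_(n - i)).
  apply: eq_bigr => i _; rewrite coef_poly ltn_ord; congr (_ * _).
  by apply: smul_poly; rewrite ltnS leq_subr.
rewrite -coefM mulrA coefM; apply: eq_bigr => i _.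
rewrite [in RHS](_ : h (n - i)%N = (\poly_(i < n.+1) h i)`_(n - i)).
  by congr (_ * _); rewrite -smul_poly.
by rewrite coef_poly ltnS leq_subr.
Qed.
Fact smul1 : left_id (sC 1) (@smul K).
Proof.
move=> f; apply: funext => n; rewrite /smul big_ord_recl /sC /= mul1r subn0.
by rewrite big1 ?addr0 // => i _; rewrite mul0r.
Qed.
Fact smulDl : left_distributive (@smul K) (@sadd K).
Proof.
move=> f g h; apply: funext => n; rewrite /smul /sadd -big_split /=.
by apply: eq_bigr => i _; rewrite mulrDl.
Qed.
Fact sone_neq0 : sC 1 != 0 :> series K.
Proof. by apply/eqP => /(congr1 (@^~ 0%N)) /eqP; rewrite oner_eq0. Qed.

HB.instance Definition _ :=
  GRing.Zmodule_isComNzRing.Build (series K) smulA smulC smul1 smulDl sone_neq0.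

Lemma coefsD f g n : (f + g) n = f n + g n. Proof. by []. Qed.
Lemma coefsN f n : (- f) n = - f n. Proof. by []. Qed.
Lemma coefsM f g n : (f * g) n = \sum_(i < n.+1) f i * g (n - i)%N.
Proof. by []. Qed.
Lemma coefs0 n : (0 : series K) n = 0. Proof. by case: n. Qed.
Lemma coefs1 n : (1 : series K) n = (n == 0%N)%:R. Proof. by case: n. Qed.
Lemma coefs_sum (I : Type) (r : seq I) (P : pred I) (F : I -> series K) n :
  (\sum_(i <- r | P i) F i) n = \sum_(i <- r | P i) F i n.
Proof. by elim/big_rec2: _ => [|i x y _ <-] //; rewrite coefs0. Qed.
Lemma coef0M f g : (f * g) 0%N = f 0%N * g 0%N.
Proof. by rewrite coefsM big_ord1. Qed.

Lemma sscaleE c f : sscale c f = sC c * f.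
Proof.
apply: funext => n; rewrite coefsM big_ord_recl /= subn0 big1 ?addr0 // => i _.
by rewrite /sC /= mul0r.
Qed.
Lemma spowE f n : spow f n = f ^+ n.
Proof. by elim: n => [|n IH] //=; rewrite IH exprS. Qed.
Lemma ssum_finE (F : nat -> series K) J : ssum_fin F J = \sum_(i < J) F i.
Proof. by elim: J => [|J IH]; rewrite ?big_ord0 ?big_ord_recr //= IH. Qed.

Lemma sC_is_additive : zmod_morphism (@sC K).
Proof.
by move=> a b; apply: funext => -[|n]; rewrite ?coefsD //= coefsN /sC /= subr0.
Qed.
Lemma sC_is_multiplicative : monoid_morphism (@sC K).
Proof.
split=> // a b; rewrite -sscaleE; apply: funext => -[|n] //.
by rewrite /sscale /sC /= mulr0.
Qed.
HB.instance Definition _ :=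
  GRing.isZmodMorphism.Build K (series K) (@sC K) sC_is_additive.
HB.instance Definition _ :=
  GRing.isMonoidMorphism.Build K (series K) (@sC K) sC_is_multiplicative.

(** * The q-adic topology *)

(** Divisibility by [q^n]; these ideals are the basic neighbourhoods of 0. *)
Definition sdvd n f := forall i, (i < n)%N -> f i = 0.

Lemma sdvd0 n : sdvd n 0. Proof. by move=> i _; rewrite coefs0. Qed.
Lemma sdvdD n f g : sdvd n f -> sdvd n g -> sdvd n (f + g).
Proof. by move=> hf hg i ni; rewrite coefsD hf // hg // addr0. Qed.
Lemma sdvdN n f : sdvd n f -> sdvd n (- f).
Proof. by move=> hf i ni; rewrite coefsN hf // oppr0. Qed.
Lemma sdvdM n m f g : sdvd n f -> sdvd m g -> sdvd (n + m) (f * g).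
Proof.
move=> hf hg i ni; rewrite coefsM big1 // => j _.
have [jn|nj] := ltnP j n; first by rewrite hf // mul0r.
by rewrite hg ?mulr0 //; have := ltn_ord j; lia.
Qed.
Lemma sdvdMr n f g : sdvd n f -> sdvd n (f * g).
Proof. by move=> hf; rewrite -[n]addn0; apply: sdvdM. Qed.
Lemma sdvdMl n f g : sdvd n g -> sdvd n (f * g).
Proof. by move=> hg; rewrite mulrC; apply: sdvdMr. Qed.
Lemma sdvdX n f : sdvd 1 f -> sdvd n (f ^+ n).
Proof.
by move=> hf; elim: n => [|n IH] //; rewrite exprS -add1n; apply: sdvdM.
Qed.
Lemma sdvdW n m f : (m <= n)%N -> sdvd n f -> sdvd m f.
Proof. by move=> mn hf i im; apply: hf; apply: leq_trans mn. Qed.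
Lemma sdvd_sum n (I : Type) (r : seq I) (P : pred I) (F : I -> series K) :
  (forall i, P i -> sdvd n (F i)) -> sdvd n (\sum_(i <- r | P i) F i).
Proof.
by move=> h; apply: big_ind => //; [exact: sdvd0 | move=> *; apply: sdvdD].
Qed.
Lemma sdvd_eq0 f : (forall n, sdvd n f) -> f = 0.
Proof. by move=> h; apply: funext => n; rewrite coefs0 (h n.+1). Qed.
Lemma sdvd1P f : sdvd 1 f <-> f 0%N = 0.
Proof. by split=> [h|h [|i]] //; apply: h. Qed.

Definition scvg (s : nat -> series K) f :=
  forall n, exists J, forall j, (J <= j)%N -> sdvd n (s j - f).

Lemma scvg_cst f : scvg (fun=> f) f.
Proof. by move=> n; exists 0%N => j _; rewrite subrr; apply: sdvd0. Qed.
Lemma scvgD s t f g : scvg s f -> scvg t g -> scvg (fun n => s n + t n) (f + g).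
Proof.
move=> hs ht n; have [J hJ] := hs n; have [L hL] := ht n.
exists (maxn J L) => j; rewrite geq_max => /andP[Jj Lj].
rewrite (_ : _ - _ = (s j - f) + (t j - g)); last by ring.
by apply: sdvdD; [apply: hJ | apply: hL].
Qed.
Lemma scvgM s t f g : scvg s f -> scvg t g -> scvg (fun n => s n * t n) (f * g).
Proof.
move=> hs ht n; have [J hJ] := hs n; have [L hL] := ht n.
exists (maxn J L) => j; rewrite geq_max => /andP[Jj Lj].
rewrite (_ : _ - _ = (s j - f) * t j + f * (t j - g)); last by ring.
by apply: sdvdD; [apply/sdvdMr/hJ | apply/sdvdMl/hL].
Qed.
Lemma scvgMl f s g : scvg s g -> scvg (fun n => f * s n) (f * g).
Proof. by apply: scvgM; apply: scvg_cst. Qed.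
Lemma scvgN s f : scvg s f -> scvg (fun n => - s n) (- f).
Proof.
move=> hs n; have [J hJ] := hs n; exists J => j Jj.
by rewrite -opprD; apply/sdvdN/hJ.
Qed.
Lemma scvgB s t f g : scvg s f -> scvg t g -> scvg (fun n => s n - t n) (f - g).
Proof. by move=> hs ht; apply/scvgD/scvgN. Qed.
Lemma scvg_ext s t f : s =1 t -> scvg s f -> scvg t f.
Proof. by move=> /funext ->. Qed.
(** The bound forces [u] to infinity, without monotonicity; the offset [k] admits truncated shifts
    such as [N - i.+1]. *)
Lemma scvg_sub (u : nat -> nat) k s f : (forall n, (n <= u (k + n))%N) ->
  scvg s f -> scvg (fun n => s (u n)) f.
Proof.
move=> hu hs n; have [J hJ] := hs n; exists (k + J)%N => j Jj; apply: hJ.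
rewrite -(subnKC (leq_trans (leq_addr J k) Jj)); apply: leq_trans (hu _); lia.
Qed.
Lemma scvg0 s : (forall n, sdvd n (s n)) -> scvg s 0.
Proof. by move=> h n; exists n => j nj; rewrite subr0; apply: sdvdW (h j). Qed.
Lemma scvg_unique s f g : scvg s f -> scvg s g -> f = g.
Proof.
move=> hf hg; apply/eqP; rewrite -subr_eq0; apply/eqP/sdvd_eq0 => n.
have [J hJ] := hf n; have [L hL] := hg n.
rewrite (_ : _ - _ = (s (maxn J L) - g) - (s (maxn J L) - f)); last by ring.
by apply: sdvdD; [apply: hL|apply/sdvdN/hJ]; rewrite leq_max leqnn ?orbT.
Qed.
Lemma sdvd_lim n s f g : scvg s f -> (forall j, sdvd n (s j - g)) -> sdvd n (f - g).
Proof.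
move=> hs h; have [J hJ] := hs n.
rewrite (_ : _ - _ = (s J - g) - (s J - f)); last by ring.
by apply: sdvdD => //; apply/sdvdN/hJ.
Qed.

Lemma slimE s f : scvg s f -> slim s = f.
Proof.
move=> hs; apply: funext => n; rewrite /slim.
have [J hJ] := hs n.+1.
have hn j : (J <= j)%N -> s j n = f n.
  by move=> Jj; apply/eqP; rewrite -subr_eq0 -coefsN -coefsD hJ.
have ex : exists a, exists J, forall j, (J <= j)%N -> s j n = a.
  by exists (f n), J.
(* The value chosen by [epsilon] and [f n] are both eventual values, hence agree at an index beyond
   both thresholds. *)
have [L hL] := ClassicalEpsilon.epsilon_spec (inhabits 0) _ ex.
by rewrite -(hL (maxn J L)) ?hn // ?leq_maxl // leq_maxr.
Qed.

(** * Infinite sums *)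

Definition has_ssum (F : nat -> series K) f :=
  scvg (fun N => \sum_(i < N) F i) f.

Lemma ssumE F f : has_ssum F f -> ssum F = f.
Proof.
by move=> h; apply: slimE; apply: scvg_ext h => N; rewrite ssum_finE.
Qed.
Lemma has_ssum_ssum F : (forall n, sdvd n (F n)) -> has_ssum F (ssum F).
Proof.
(* Terms of index above [n] do not reach the coefficient of [q^n], so that coefficient is final
   after [n.+1] terms. *)
move=> hF; pose f : series K := fun n => (\sum_(i < n.+1) F i) n.
suff h : has_ssum F f by rewrite (ssumE h).
move=> n; exists n => j nj i ni; rewrite coefsD coefsN; apply/eqP.
rewrite subr_eq0 /f -(subnKC (leq_trans ni nj)) big_split_ord /= coefsD.
rewrite -[eqbRHS]addr0; apply/eqP; congr (_ + _).
rewrite coefs_sum big1 // => k _.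
by apply: (hF (i.+1 + k)%N); lia.
Qed.
Lemma eq_has_ssum F G f : F =1 G -> has_ssum F f -> has_ssum G f.
Proof. by move=> /funext ->. Qed.
Lemma has_ssumMl a F f : has_ssum F f -> has_ssum (fun n => a * F n) (a * f).
Proof. by move=> hF; apply: scvg_ext (scvgMl a hF) => N; rewrite mulr_sumr. Qed.
Lemma has_ssumB F G f g :
  has_ssum F f -> has_ssum G g -> has_ssum (fun n => F n - G n) (f - g).
Proof.
by move=> hF hG; apply: scvg_ext (scvgB hF hG) => N; rewrite sumrB.
Qed.
Lemma has_ssum_unique F f g : has_ssum F f -> has_ssum F g -> f = g.
Proof. exact: scvg_unique. Qed.
Lemma has_ssum_telescope (E F : nat -> series K) f :
  (forall n, F n = E n.+1 - E n) -> scvg E f -> has_ssum F (f - E 0%N).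
Proof.
move=> hF hE; apply: scvg_ext (scvgB hE (scvg_cst (E 0%N))) => N.
by rewrite -(telescope_sumr E (leq0n N)) big_mkord; apply: eq_bigr.
Qed.
Lemma has_ssum_odd F f g : has_ssum F f -> has_ssum (fun n => (-1) ^+ n * F n) g ->
  has_ssum (fun n => 2%:R * F (2 * n + 1)%N) (f - g).
Proof.
move=> hf hg.
(* Along partial sums of even length, each pair of consecutive terms loses its even term and doubles
   its odd one. *)
have h := @scvg_sub (fun n => 2 * n)%N 0 _ _ _ (scvgB hf hg).
apply: scvg_ext (h _); last by move=> n; lia.
elim=> [|N IH] /=; first by rewrite muln0 !big_ord0 subrr.
rewrite [RHS]big_ord_recr /= -IH mulnS !add2n !big_ord_recr /= addn1.
by rewrite exprS exprM sqrrN !expr1n; ring.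
Qed.
(* Tannery: the divisibility of [F N i] by [q^i] is uniform in [N]. *)
Lemma scvg_tannery (F : nat -> nat -> series K) (G : nat -> series K) f :
  (forall N i, sdvd i (F N i)) -> (forall i, scvg (F^~ i) (G i)) ->
  has_ssum G f -> scvg (fun N => \sum_(i < N) F N i) f.
Proof.
move=> hF hG hf n.
have [J hJ] : exists J, forall j, (J <= j)%N ->
    sdvd n (\sum_(i < n) F j i - \sum_(i < n) G i).
  suff h m : scvg (fun j => \sum_(i < m) F j i) (\sum_(i < m) G i) by apply: h.
  elim: m => [|m IH].
    by rewrite big_ord0; apply: scvg_ext (scvg_cst _) => j; rewrite big_ord0.
  rewrite big_ord_recr; apply: scvg_ext (scvgD IH (hG m)) => j.
  by rewrite big_ord_recr.
have [L hL] := hf n.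
have hGn i : (n <= i)%N -> sdvd n (G i).
  move=> ni; rewrite -[G i]subr0; apply: sdvd_lim (hG i) _ => j.
  by rewrite subr0; apply: sdvdW (hF j i).
have hsplit (H : nat -> series K) m : (n <= m)%N ->
    (forall i, (n <= i)%N -> sdvd n (H i)) ->
    sdvd n (\sum_(i < m) H i - \sum_(i < n) H i).
  move=> nm hH; rewrite -(subnKC nm) big_split_ord /= addrAC subrr add0r.
  by apply: sdvd_sum => i _; apply: hH; apply: leq_addr.
exists (maxn J (maxn L n)) => j; rewrite !geq_max => /and3P[Jj Lj nj].
have h1 := hsplit (F j) j nj (fun i ni => sdvdW ni (hF j i)).
have h2 := hsplit G j nj hGn.
rewrite (_ : _ - _ = (\sum_(i < j) F j i - \sum_(i < n) F j i) +
  (\sum_(i < n) F j i - \sum_(i < n) G i) - (\sum_(i < j) G i - \sum_(i < n) G i)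
  + (\sum_(i < j) G i - f)); last by ring.
by apply: sdvdD (hL _ Lj); apply: sdvdD (sdvdN h2); apply: sdvdD h1 (hJ _ Jj).
Qed.

(** * Inverses of power series *)

Lemma sgeomK f : sdvd 1 f -> sgeom f * (1 - f) = 1.
Proof.
move=> hf.
have h : has_ssum (spow f) (sgeom f).
  by apply: has_ssum_ssum => n; rewrite spowE; apply: sdvdX.
apply: (@scvg_unique (fun n => 1 - f ^+ n)).
  apply: scvg_ext (scvgM h (scvg_cst (1 - f))) => N.
  rewrite mulrC -[1 as X in X - f ^+ N](expr1n _ N) subrXX; congr (_ * _).
  by apply: eq_bigr => i _; rewrite spowE expr1n mul1r.
rewrite -[X in scvg _ X]subr0; apply: scvgB; first exact: scvg_cst.
by apply: scvg0 => n; apply: sdvdX.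
Qed.
Lemma sinvK f : f 0%N != 0 -> sinv f * f = 1.
Proof.
move=> f0; rewrite /sinv.
set h := ssub _ _.
have hE : f = sC (f 0%N) * (1 - h).
  rewrite /h sscaleE (_ : ssub _ _ = 1 - sC (f 0%N)^-1 * f) //.
  rewrite subKr mulrA -rmorphM /= mulfV // rmorph1 mul1r //.
rewrite sscaleE [in X in _ * X]hE mulrACA -rmorphM /= mulVf // rmorph1 mul1r.
apply: sgeomK; apply/sdvd1P.
by rewrite /h /ssub /sadd /sopp /sscale /sC /= mulVf // subrr.
Qed.

Definition sunit : {pred series K} := fun f => f 0%N != 0.
(** The unit ring interface wants a total inverse that is the identity on non-units. *)
Definition stotal_inv f := if f 0%N != 0 then sinv f else f.
Fact smulV : {in sunit, left_inverse 1 stotal_inv *%R}.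
Proof. by move=> f hf; rewrite /stotal_inv ifT // sinvK. Qed.
Fact sunitP f g : g * f = 1 -> sunit f.
Proof.
move=> /(congr1 (@^~ 0%N)); rewrite coef0M coefs1 => /eqP h; apply/eqP => f0.
by move: h; rewrite f0 mulr0 eq_sym oner_eq0.
Qed.
Fact sinv_out : {in [predC sunit], stotal_inv =1 id}.
Proof. by move=> f; rewrite inE /stotal_inv => /negPf; rewrite /in_mem /= /sunit => ->. Qed.
HB.instance Definition _ :=
  GRing.ComNzRing_hasMulInverse.Build (series K) smulV sunitP sinv_out.

Lemma sunitE f : (f \is a GRing.unit) = (f 0%N != 0). Proof. by []. Qed.
Lemma sdivE f g : g \is a GRing.unit -> sdiv f g = f / g.
Proof.
by rewrite sunitE => hg; rewrite /sdiv /GRing.inv /= /stotal_inv hg.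
Qed.

(** * q-Pochhammer symbols *)

Local Notation q := (sX K).

Lemma sdvd_q : sdvd 1 q. Proof. by case. Qed.
Lemma sdvd_qX n : sdvd n (q ^+ n). Proof. exact/sdvdX/sdvd_q. Qed.

Lemma qpoch0 a : qpoch a 0 = 1. Proof. by []. Qed.
Lemma qpochSr a n : qpoch a n.+1 = qpoch a n * (1 - a * q ^+ n).
Proof. by rewrite /qpoch /= spowE. Qed.
Lemma qpochS a n : qpoch a n.+1 = (1 - a) * qpoch (a * q) n.
Proof.
elim: n => [|n IH]; first by rewrite qpochSr !qpoch0 expr0; ring.
by rewrite qpochSr IH qpochSr exprS; ring.
Qed.

Lemma scvg_qpoch a : scvg (qpoch a) (qpoch_inf a).
Proof.
have [f hf] : exists f, scvg (qpoch a) f.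
  (* Successive partial products differ by a multiple of [q^n], so the product is 1 plus a
     convergent telescoping sum. *)
  have h := @has_ssum_ssum (fun n => - (qpoch a n * a * q ^+ n))
    (fun n => sdvdN (sdvdMl _ (@sdvd_qX n))).
  eexists; apply: scvg_ext (scvgD (scvg_cst 1) h).
  elim=> [|N IH]; first by rewrite big_ord0 addr0.
  by rewrite qpochSr big_ord_recr /= addrA IH; ring.
by rewrite (_ : qpoch_inf a = f) // /qpoch_inf /sprod; apply: slimE.
Qed.
Lemma qpoch_infS a : qpoch_inf a = (1 - a) * qpoch_inf (a * q).
Proof.
apply: (@scvg_unique (fun n => qpoch a n.+1)).
  by apply: (@scvg_sub S 0 _ _ _ (scvg_qpoch a)) => n; lia.
by apply: scvg_ext (scvgMl _ (scvg_qpoch _)) => n; rewrite qpochS.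
Qed.
Lemma qpoch_inf_split a n : qpoch_inf a = qpoch a n * qpoch_inf (a * q ^+ n).
Proof.
elim: n => [|n IH]; first by rewrite expr0 mulr1 qpoch0 mul1r.
by rewrite qpochSr IH qpoch_infS exprSr !mulrA.
Qed.
Lemma sdvd_qpochB1 n a j : sdvd n a -> sdvd n (qpoch a j - 1).
Proof.
move=> ha; elim: j => [|j IH]; first by rewrite subrr; apply: sdvd0.
rewrite qpochSr (_ : _ - 1 = qpoch a j - 1 - a * (q ^+ j * qpoch a j)); last by ring.
by apply: sdvdD => //; apply/sdvdN/sdvdMr.
Qed.
Lemma sdvd_qpoch_infB1 n a : sdvd n a -> sdvd n (qpoch_inf a - 1).
Proof. by move=> ha; apply: sdvd_lim (scvg_qpoch a) _ => j; apply: sdvd_qpochB1. Qed.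
Lemma scvg_qpoch_inf1 (a : nat -> series K) :
  (forall n, sdvd n (a n)) -> scvg (fun n => qpoch_inf (a n)) 1.
Proof. by move=> ha n; exists n => j nj; apply/sdvd_qpoch_infB1/(sdvdW nj). Qed.

Lemma unit1B f : sdvd 1 f -> 1 - f \is a GRing.unit.
Proof. by move/sdvd1P=> h; rewrite sunitE coefsD coefsN h subr0 coefs1 oner_eq0. Qed.
Lemma unit_of_sdvdB1 f : sdvd 1 (f - 1) -> f \is a GRing.unit.
Proof. by move=> h; rewrite (_ : f = 1 - - (f - 1)); [apply/unit1B/sdvdN | ring]. Qed.
Lemma qpoch_unit a n : sdvd 1 a -> qpoch a n \is a GRing.unit.
Proof. by move=> ha; apply/unit_of_sdvdB1/sdvd_qpochB1. Qed.
Lemma qpoch_inf_unit a : sdvd 1 a -> qpoch_inf a \is a GRing.unit.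
Proof. by move=> ha; apply/unit_of_sdvdB1/sdvd_qpoch_infB1. Qed.

(** * A contiguous relation for a 2phi1 with argument q *)

(** The term of 2phi1(x, y; c; q, q) multiplied by (q)_oo (c)_oo, which clears its denominators
    (q)_n (c)_n. *)
Definition heine_term (x y c : series K) n :=
  q ^+ n * qpoch x n * qpoch y n * qpoch_inf (q ^+ n.+1) * qpoch_inf (c * q ^+ n).

Lemma has_ssum_heine x y c : has_ssum (heine_term x y c) (ssum (heine_term x y c)).
Proof. by apply: has_ssum_ssum => n; rewrite /heine_term -!mulrA; apply/sdvdMr/sdvd_qX. Qed.

Lemma heine_contiguous x y c :
  ssum (heine_term x y c) = qpoch_inf (x * q) * qpoch_inf (y * q)
    + (x * y * q - c) * ssum (heine_term (x * q) (y * q) (c * q)).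
Proof.
(* Telescoping certificate. It is shifted by one index and extended by 0, so that the sum equals its
   limit with no boundary term at 0. *)
pose D n := (1 - x * y * q ^+ n.+1) * qpoch (x * q) n * qpoch (y * q) n
  * qpoch_inf (q ^+ n.+1) * qpoch_inf (c * q ^+ n.+1).
pose E n := if n is m.+1 then D m else 0.
have hE : scvg E (qpoch_inf (x * q) * qpoch_inf (y * q)).
  suff hD : scvg D (qpoch_inf (x * q) * qpoch_inf (y * q)).
    move=> n; have [J hJ] := hD n; exists J.+1 => -[|j] //; exact: hJ.
  have hq n : sdvd n (q ^+ n.+1) by apply: (sdvdW (leqnSn n)); apply: sdvd_qX.
  rewrite (_ : _ * _ = (1 - 0) * qpoch_inf (x * q) * qpoch_inf (y * q) * 1 * 1);
    last by ring.
  do 4 ?apply: scvgM; try exact: scvg_qpoch.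
  - by apply: scvgB (scvg_cst _) _; apply: scvg0 => n; apply: sdvdMl.
  - exact: scvg_qpoch_inf1.
  - by apply: scvg_qpoch_inf1 => n; apply: sdvdMl.
have h := has_ssumB (has_ssum_heine x y c)
  (has_ssumMl (x * y * q - c) (has_ssum_heine (x * q) (y * q) (c * q))).
suff hF n : heine_term x y c n -
    (x * y * q - c) * heine_term (x * q) (y * q) (c * q) n = E n.+1 - E n.
  rewrite -[LHS](subrK ((x * y * q - c) * ssum (heine_term (x * q) (y * q) (c * q)))).
  by rewrite (has_ssum_unique h (has_ssum_telescope hF hE)) subr0.
case: n => [|n].
  rewrite -[E 1%N]/(D 0%N) /D /heine_term !qpoch0 !expr0 !expr1 !mulr1.
  by rewrite (qpoch_infS c) /=; ring.
rewrite -[E n.+2]/(D n.+1) -[E n.+1]/(D n) /D /heine_term.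
rewrite (qpoch_infS (q ^+ n.+1)) (qpoch_infS (c * q ^+ n.+1)).
rewrite (qpochS x) (qpochS y) !(qpochSr (_ * q)) !exprS.
have e : c * q * (q * q ^+ n) = c * (q * q ^+ n) * q by ring.
have e' : q * (q * q ^+ n) = q * q ^+ n * q by ring.
by rewrite e e' (mulrA c (q * q ^+ n) q); ring.
Qed.

(** The contiguous relation is iterated: its k-th use contributes the factor with index [k]. As [q]
    divides [c], it divides every such factor, so the remainder after N steps is divisible by
    [q^N]. *)
Lemma heine_transform x y c : sdvd 1 c ->
  has_ssum (fun n => (\prod_(k < n) (x * y * q ^+ (2 * k + 1) - c * q ^+ k))
      * qpoch_inf (x * q ^+ n.+1) * qpoch_inf (y * q ^+ n.+1))
    (ssum (heine_term x y c)).
Proof.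
move=> hc.
pose W n := \prod_(k < n) (x * y * q ^+ (2 * k + 1) - c * q ^+ k).
have WS n : W n.+1 = W n * (x * y * q ^+ (2 * n + 1) - c * q ^+ n).
  by rewrite /W big_ord_recr.
have hW n : sdvd n (W n).
  elim: n => [|n IH] //; rewrite WS -addn1; apply: sdvdM IH _; apply: sdvdD.
    by apply: sdvdMl; rewrite addn1 exprS; apply/sdvdMr/sdvd_q.
  exact/sdvdN/sdvdMr.
pose T n := ssum (heine_term (x * q ^+ n) (y * q ^+ n) (c * q ^+ n)).
have hT : scvg (fun N => T 0%N - W N * T N) (T 0%N).
  rewrite -[X in scvg _ X]subr0; apply: scvgB; first exact: scvg_cst.
  by apply: scvg0 => n; apply: sdvdMr.
rewrite (_ : ssum _ = T 0%N); last by rewrite /T !expr0 !mulr1.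
apply: scvg_ext hT; elim=> [|N IH].
  by rewrite /W !big_ord0 mul1r subrr.
have TS : T N = qpoch_inf (x * q ^+ N.+1) * qpoch_inf (y * q ^+ N.+1)
    + (x * y * q ^+ (2 * N + 1) - c * q ^+ N) * T N.+1.
  rewrite /T heine_contiguous -!mulrA -!exprSr; congr (_ + _ * _).
  by rewrite mul2n -addnn !exprD exprS expr1; ring.
by rewrite big_ord_recr /= -IH -/(W N) WS TS; ring.
Qed.

(** * The q-Gauss sum *)

(** The term of 2phi1(x, y; dxy; q, d) multiplied by (q)_oo (dxy)_oo. Taking the argument [d] as
    parameter avoids the usual quotient c/(xy). *)
Definition gauss_term (x y d : series K) n :=
  d ^+ n * qpoch x n * qpoch y n * qpoch_inf (q ^+ n.+1)
  * qpoch_inf (d * x * y * q ^+ n).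

Lemma sdvd_gauss_term x y d n : sdvd 1 d -> sdvd n (gauss_term x y d n).
Proof. by move=> hd; rewrite /gauss_term -!mulrA; apply/sdvdMr/sdvdX. Qed.

Lemma has_ssum_gauss x y d :
  sdvd 1 d -> has_ssum (gauss_term x y d) (ssum (gauss_term x y d)).
Proof. by move=> hd; apply: has_ssum_ssum => n; apply: sdvd_gauss_term. Qed.

Lemma gauss_contiguous x y d : sdvd 1 d ->
  (1 - d) * ssum (gauss_term x y d) =
  (1 - d * x) * (1 - d * y) * ssum (gauss_term x y (d * q)).
Proof.
move=> hd; have hdq : sdvd 1 (d * q) by apply: sdvdMr.
pose s n := d ^+ n * qpoch x n * qpoch y n * qpoch_inf (q ^+ n.+1)
  * qpoch_inf (d * x * y * q ^+ n.+1).
(* Telescoping certificate: the factor [1 - q ^+ n] kills [E 0] and [d ^+ n] sends [E] to 0, so the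
   sum of differences vanishes. *)
pose E n := - (s n * (1 - q ^+ n) * (1 - d * x * y * q ^+ n)).
have hE : scvg E 0.
  by apply: scvg0 => n; rewrite /E /s -!mulrA; apply/sdvdN/sdvdMr/sdvdX.
have h := has_ssumB (has_ssumMl (1 - d) (has_ssum_gauss x y hd))
  (has_ssumMl ((1 - d * x) * (1 - d * y)) (has_ssum_gauss x y hdq)).
apply/eqP; rewrite -subr_eq0; apply/eqP.
suff hF n : (1 - d) * gauss_term x y d n -
    (1 - d * x) * (1 - d * y) * gauss_term x y (d * q) n = E n.+1 - E n.
  rewrite (has_ssum_unique h (has_ssum_telescope hF hE)) /E expr0; ring.
rewrite /E /s /gauss_term !(qpochSr _ n) exprMn.
rewrite (qpoch_infS (d * x * y * q ^+ n)) (qpoch_infS (q ^+ n.+1)).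
rewrite (qpoch_infS (d * x * y * q ^+ n.+1)).
have -> : d * q * x * y * q ^+ n = d * x * y * q ^+ n.+1 by rewrite exprS; ring.
have -> : d * x * y * q ^+ n * q = d * x * y * q ^+ n.+1 by rewrite exprS; ring.
have -> : d * x * y * q ^+ n.+2 = d * x * y * q ^+ n.+1 * q by rewrite !exprS; ring.
rewrite -(exprSr q n.+1) (qpoch_infS (d * x * y * q ^+ n.+1)) !exprS; ring.
Qed.

(** Modulo [d] only the term of index 0 survives, and it reduces to (q)_oo; this gives the limit of
    the iteration below. *)
Lemma sdvd_gaussB n x y d : (0 < n)%N -> sdvd n d ->
  sdvd n (ssum (gauss_term x y d) - qpoch_inf q).
Proof.
move=> n0 hd; have hd1 := sdvdW n0 hd.
have h := @scvg_sub S 0 _ _ _ (has_ssum_gauss x y hd1).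
apply: sdvd_lim (h _) _ => [i|j]; first by lia.
rewrite big_ord_recl addrAC; apply: sdvdD; last first.
  apply: sdvd_sum => i _; rewrite lift0 /gauss_term -!mulrA; apply: sdvdMr.
  by rewrite exprS; apply: sdvdMr.
rewrite /gauss_term /= !qpoch0 !expr0 expr1 !mulr1 mul1r.
rewrite -[X in _ - X]mulr1 -mulrBr; apply/sdvdMl/sdvd_qpoch_infB1.
by rewrite -mulrA; apply: sdvdMr.
Qed.

(** Iterating the relation gives (d)_n G(0) = (dx)_n (dy)_n G(n), where G(n) tends to (q)_oo. *)
Lemma gauss_sum x y d : sdvd 1 d ->
  qpoch_inf d * ssum (gauss_term x y d) =
  qpoch_inf (d * x) * qpoch_inf (d * y) * qpoch_inf q.
Proof.
move=> hd; pose G n := ssum (gauss_term x y (d * q ^+ n)).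
have hG : scvg G (qpoch_inf q).
  move=> n; exists n.+1 => -[|j] // nj.
  apply: (@sdvdW j.+1); first by lia.
  by apply: sdvd_gaussB => //; apply/sdvdMl/sdvd_qX.
apply: (@scvg_unique (fun n => qpoch d n * G 0%N)).
  rewrite /G expr0 mulr1; apply: scvgM (scvg_cst _); exact: scvg_qpoch.
apply: scvg_ext (scvgM (scvgM (scvg_qpoch _) (scvg_qpoch _)) hG) => n.
elim: n => [|n IH]; first by rewrite !qpoch0 !mul1r.
have hdn : sdvd 1 (d * q ^+ n) by apply: sdvdMr.
have hn : (1 - d * q ^+ n) * G n =
    (1 - d * x * q ^+ n) * (1 - d * y * q ^+ n) * G n.+1.
  rewrite /G gauss_contiguous // exprSr !mulrA; congr ((1 - _) * (1 - _) * _); ring.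
have -> : qpoch d n.+1 * G 0%N = (1 - d * q ^+ n) * (qpoch d n * G 0%N).
  by rewrite qpochSr; ring.
by rewrite -IH [RHS]mulrCA hn !qpochSr; ring.
Qed.

(** * Partial fractions of a theta quotient *)

Lemma scvgV s f : (forall n, s n \is a GRing.unit) -> f \is a GRing.unit ->
  scvg s f -> scvg (fun n => (s n)^-1) f^-1.
Proof.
move=> us uf hs n; have [J hJ] := hs n; exists J => j Jj.
rewrite (_ : _ - _ = (s j - f) * - ((s j)^-1 * f^-1)); first exact/sdvdMr/hJ.
apply: (mulrI (us j)); apply: (mulrI uf).
transitivity (f * (s j / s j) - s j * (f / f)); first by ring.
rewrite !mulrV //.
transitivity (- (s j / s j) * (f / f) * (s j - f)); last by ring.
by rewrite !mulrV //; ring.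
Qed.

(** These quotients build the partial fraction coefficients; their limit is the overpartition
    generating function. *)
Definition qpoch_quot n : series K := qpoch (- q) n / qpoch q n.

Lemma qpoch_quot0 : qpoch_quot 0 = 1.
Proof. by rewrite /qpoch_quot !qpoch0 divr1. Qed.
Lemma qpoch_quotS n :
  qpoch_quot n.+1 * (1 - q ^+ n.+1) = qpoch_quot n * (1 + q ^+ n.+1).
Proof.
have u m : qpoch q m \is a GRing.unit by apply/qpoch_unit/sdvd_q.
apply: (mulrI (u n.+1)); rewrite /qpoch_quot.
transitivity (qpoch (- q) n.+1 * (1 - q ^+ n.+1) * (qpoch q n.+1 / qpoch q n.+1));
  first by ring.
rewrite mulrV // !qpochSr -exprS mulNr -exprS.
transitivity (qpoch (- q) n * (1 - q ^+ n.+1) * (1 + q ^+ n.+1) * (qpoch q n / qpoch q n));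
  last by ring.
by rewrite mulrV //; ring.
Qed.
Lemma scvg_qpoch_quot : scvg qpoch_quot (qpoch_inf (- q) / qpoch_inf q).
Proof.
apply: scvgM; first exact: scvg_qpoch.
by apply: scvgV (scvg_qpoch _) => [n|]; [apply: qpoch_unit|apply: qpoch_inf_unit]; apply: sdvd_q.
Qed.

(** The hypotheses say a' - a = A (a' + a) and b' - b = B (b' + b); the product of these two
    equations rearranges to the claim. *)
Lemma cross_sums (R : comPzRingType) (A B a b a' b' : R) :
  a' * (1 - A) = a * (1 + A) -> b' * (1 - B) = b * (1 + B) ->
  (1 - A * B) * (a' * b' + a * b) = (1 + A * B) * (a * b' + a' * b).
Proof.
move=> ha hb.
have ea : a' - a = A * (a' + a).
  by apply/eqP; rewrite -subr_eq0 -(subrr (a * (1 + A))) -{1}ha; apply/eqP; ring.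
have eb : b' - b = B * (b' + b).
  by apply/eqP; rewrite -subr_eq0 -(subrr (b * (1 + B))) -{1}hb; apply/eqP; ring.
apply/eqP; rewrite -subr_eq0.
rewrite (_ : _ - _ = (a' - a) * (b' - b) - A * B * ((a' + a) * (b' + b))); last by ring.
by rewrite ea eb; apply/eqP; ring.
Qed.

Section ThetaQuotient.
Variables (x y : series K).
Hypothesis xy1 : x * y = 1.

Definition lambert n : series K :=
  (1 - x) * (1 - y) * q ^+ n / ((1 - x * q ^+ n) * (1 - y * q ^+ n)).

Lemma lambert_den_unit n : (0 < n)%N ->
  (1 - x * q ^+ n) * (1 - y * q ^+ n) \is a GRing.unit.
Proof.
move=> n0; have hq : sdvd 1 (q ^+ n) by apply: sdvdW n0 (@sdvd_qX n).
by rewrite unitrMl; apply/unit1B/sdvdMl.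
Qed.
Lemma lambertK n : (0 < n)%N ->
  (1 - x * q ^+ n) * (1 - y * q ^+ n) * lambert n = (1 - x) * (1 - y) * q ^+ n.
Proof. by move=> n0; rewrite /lambert mulrC divrK //; apply: lambert_den_unit. Qed.
Lemma sdvd_lambert n : sdvd n (lambert n).
Proof. by apply/sdvdMr/sdvdMl/sdvd_qX. Qed.

(* Partial fraction expansion of the product
   [\prod_(1 <= k <= N) (1 + x q^k) (1 + y q^k) / ((1 - x q^k) (1 - y q^k))]. *)
Definition theta_pf N : series K := qpoch_quot N ^+ 2 + 2%:R *
  \sum_(i < N) (-1) ^+ i.+1 * qpoch_quot (N + i.+1) * qpoch_quot (N - i.+1) * lambert i.+1.

(* Up to the factor [1 - q^(2N+2)], the difference of the two sides telescopes in
   the summation index: each denominator [(1 - x q^j) (1 - y q^j)] is traded for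
   [(1 - x Q) (1 - y Q)] with [Q = q^(N+1)], which cancels all remaining
   dependence on [x] and [y]. *)
Lemma theta_pfS N :
  (1 - x * q ^+ N.+1) * (1 - y * q ^+ N.+1) * theta_pf N.+1 =
  (1 + x * q ^+ N.+1) * (1 + y * q ^+ N.+1) * theta_pf N.
Proof.
set Q := q ^+ N.+1.
have uQ : 1 - Q * Q \is a GRing.unit by apply/unit1B/sdvdMr/(@sdvdW N.+1)/sdvd_qX.
set d := (1 - x * Q) * _; set e := (1 + x * Q) * _.
have pE : (1 - x) * (1 - y) = 2%:R - (x + y).
  transitivity (1 + x * y - (x + y)); first by ring.
  by rewrite xy1; ring.
have dE : d = (1 - x) * (1 - y) * Q + (1 - Q) * (1 - Q).
  transitivity (1 - (x + y) * Q + x * y * (Q * Q)); first by rewrite /d; ring.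
  transitivity (1 - (x + y) * Q + Q * Q + (x * y - 1) * Q); last by ring.
  by rewrite xy1; ring.
have eE : e = (1 + Q) * (1 + Q) - (1 - x) * (1 - y) * Q.
  transitivity (1 + (x + y) * Q + x * y * (Q * Q)); first by rewrite /e; ring.
  transitivity (1 + (x + y) * Q + Q * Q - (x * y - 1) * Q); last by ring.
  by rewrite xy1; ring.
pose w := (1 - x) * (1 - y) * Q * (1 + Q * Q).
(* Telescoping potential: its end values [g 1] and [g N.+1] will be cancelled by the squared terms
   and by the last summand of [theta_pf N.+1]. *)
pose g j := (-1) ^+ j * qpoch_quot (N + j) * qpoch_quot (N.+1 - j).
have step i : (i < N)%N ->
  (1 - Q * Q) * (d * ((-1) ^+ i.+1 * qpoch_quot (N.+1 + i.+1) * qpoch_quot (N.+1 - i.+1) * lambert i.+1)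
   - e * ((-1) ^+ i.+1 * qpoch_quot (N + i.+1) * qpoch_quot (N - i.+1) * lambert i.+1))
  = w * (g i.+1 - g i.+2).
  move=> iN; rewrite /g /w.
  have -> : (N.+1 - i.+2 = N - i.+1)%N by [].
  have -> : (N.+1 - i.+1 = (N - i.+1).+1)%N by lia.
  rewrite addSn (addnS N i.+1).
  have QE : Q * Q = q ^+ (N + i.+1).+1 * q ^+ (N - i.+1).+1.
    by rewrite /Q -!exprD; congr (_ ^+ _); lia.
  have QB : Q = q ^+ (N - i.+1).+1 * q ^+ i.+1.
    by rewrite /Q -!exprD; congr (_ ^+ _); lia.
  have AB : q ^+ (N + i.+1).+1 = q ^+ (N - i.+1).+1 * q ^+ i.+1 * q ^+ i.+1.
    by rewrite -!exprD; congr (_ ^+ _); lia.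
  have ha := qpoch_quotS (N + i.+1).
  have hb := qpoch_quotS (N - i.+1).
  have hc := cross_sums ha hb.
  have hl := @lambertK i.+1 isT.
  rewrite -QE in hc.
  set A := q ^+ (N + i.+1).+1 in QE AB ha hc *.
  set B := q ^+ (N - i.+1).+1 in QE QB AB hb hc *.
  set a' := qpoch_quot (N + i.+1).+1 in ha hc *.
  set a := qpoch_quot (N + i.+1) in ha hc *.
  set b' := qpoch_quot (N - i.+1).+1 in hb hc *.
  set b := qpoch_quot (N - i.+1) in hb hc *.
  set u := lambert i.+1 in hl *.
  set r := q ^+ i.+1 in QB AB hl *.
  (* Since Q = B r and A = B r^2, subtracting B times the denominator of [u] from [d] leaves (1 - A)
     (1 - B). Adding it to [e] leaves (1 + A) (1 + B). *)
  have hd : d * u = B * ((1 - x) * (1 - y) * r) + (1 - A) * (1 - B) * u.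
    rewrite -hl dE QB AB.
    transitivity (B * ((1 - (x + y) * r + x * y * (r * r)) * u) +
       (1 - B * r * r) * (1 - B) * u); last by ring.
    by rewrite xy1 pE; ring.
  have he : e * u = - (B * ((1 - x) * (1 - y) * r)) + (1 + A) * (1 + B) * u.
    rewrite -hl eE QB AB.
    transitivity (- (B * ((1 - (x + y) * r + x * y * (r * r)) * u)) +
       (1 + B * r * r) * (1 + B) * u); last by ring.
    by rewrite xy1 pE; ring.
  transitivity ((-1) ^+ i.+1 * (1 - Q * Q) * (a' * b' * (d * u) - a * b * (e * u)));
    first by ring.
  rewrite hd he.
  (* The part containing [u] vanishes by [ha] and [hb]; in the rest, [hc] trades 1 - Q^2 for 1 + Q^2
     and leaves a difference of values of [g]. *)
  transitivity ((-1) ^+ i.+1 * ((1 - x) * (1 - y) * (B * r) * ((1 - Q * Q) * (a' * b' + a * b))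
    + (1 - Q * Q) * u * ((a' * (1 - A)) * (b' * (1 - B)) - a * (1 + A) * (b * (1 + B)))));
      first by ring.
  by rewrite hc ha hb -QB (exprS _ i.+1); ring.
have last_step : (1 - Q * Q) * (d * ((-1) ^+ N.+1 * qpoch_quot (N.+1 + N.+1) * qpoch_quot (N.+1 - N.+1)
    * lambert N.+1)) = w * g N.+1.
  rewrite /g /w subnn qpoch_quot0 addSn.
  have hl := @lambertK N.+1 isT; rewrite -/Q -/d in hl.
  have ha := qpoch_quotS (N + N.+1).
  have QE : q ^+ (N + N.+1).+1 = Q * Q.
    by rewrite /Q -exprD; congr (_ ^+ _).
  rewrite QE in ha.
  transitivity ((-1) ^+ N.+1 * (qpoch_quot (N + N.+1).+1 * (1 - Q * Q)) * (d * lambert N.+1));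
    first by ring.
  by rewrite hl ha; ring.
have first_step : (1 - Q * Q) * (d * qpoch_quot N.+1 ^+ 2 - e * qpoch_quot N ^+ 2) = - (2%:R * (w * g 1%N)).
  have ha := qpoch_quotS N; rewrite -/Q in ha.
  have hc := cross_sums ha ha.
  rewrite /g /w addn1 subn1 /= dE eE.
  transitivity ((1 - x) * (1 - y) * Q * ((1 - Q * Q) * (qpoch_quot N.+1 * qpoch_quot N.+1 + qpoch_quot N * qpoch_quot N))
    + (1 - Q * Q) * ((qpoch_quot N.+1 * (1 - Q)) * (qpoch_quot N.+1 * (1 - Q)) - qpoch_quot N * (1 + Q) * (qpoch_quot N * (1 + Q))));
      first by ring.
  by rewrite hc ha; ring.
apply: (mulrI uQ); apply/eqP; rewrite -subr_eq0; apply/eqP.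
rewrite /theta_pf big_ord_recr /=.
set S1 := \sum_(i < N) _; set S2 := \sum_(i < N) _.
have hS : (1 - Q * Q) * (d * S1 - e * S2) = w * (g 1%N - g N.+1).
  rewrite /S1 /S2 !mulr_sumr -sumrB mulr_sumr.
  rewrite (eq_bigr (fun i : 'I_N => w * (g i.+1 - g i.+2)));
    last by move=> i _; apply: step.
  rewrite -mulr_sumr; congr (_ * _).
  rewrite -opprB -(telescope_sumr (fun i => g i.+1) (leq0n N)) big_mkord -sumrN.
  by apply: eq_bigr => i _; rewrite opprB.
set t := _ * lambert N.+1.
transitivity ((1 - Q * Q) * (d * qpoch_quot N.+1 ^+ 2 - e * qpoch_quot N ^+ 2)
  + 2%:R * ((1 - Q * Q) * (d * S1 - e * S2)) + 2%:R * ((1 - Q * Q) * (d * t)));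
    first by ring.
by rewrite first_step hS /t last_step; ring.
Qed.

Lemma theta_pf_prod N : qpoch (x * q) N * qpoch (y * q) N * theta_pf N =
  qpoch (- (x * q)) N * qpoch (- (y * q)) N.
Proof.
elim: N => [|N IH].
  by rewrite !qpoch0 /theta_pf big_ord0 qpoch_quot0; ring.
rewrite !qpochSr !mulNr -!mulrA -!exprS !opprK.
have := theta_pfS N; set a := 1 - _; set b := 1 - _ => h.
transitivity (qpoch (x * q) N * qpoch (y * q) N * (a * b * theta_pf N.+1));
  first by ring.
rewrite h; transitivity ((1 + x * q ^+ N.+1) * (1 + y * q ^+ N.+1) *
  (qpoch (x * q) N * qpoch (y * q) N * theta_pf N)); first by ring.
by rewrite IH; ring.
Qed.

(** For fixed [i] both quotients in the summand tend to the same limit, and [lambert i.+1] makes the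
    summand divisible by [q^i] for every N, so Tannery applies. *)
Lemma scvg_theta_pf :
  scvg theta_pf ((qpoch_inf (- q) / qpoch_inf q) ^+ 2 *
    (1 + 2%:R * ssum (fun i => (-1) ^+ i.+1 * lambert i.+1))).
Proof.
set C := _ / _; set L := ssum _.
have hL : has_ssum (fun i => C ^+ 2 * ((-1) ^+ i.+1 * lambert i.+1)) (C ^+ 2 * L).
  apply/has_ssumMl/has_ssum_ssum => n.
  by apply: sdvdMl; apply: (sdvdW (leqnSn n)); apply: sdvd_lambert.
rewrite mulrDr mulr1 mulrCA; apply: scvgD.
  by rewrite expr2; apply: scvg_ext (scvgM scvg_qpoch_quot scvg_qpoch_quot).
apply: scvgMl; apply: (@scvg_tannery (fun N i => (-1) ^+ i.+1 * qpoch_quot (N + i.+1)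
  * qpoch_quot (N - i.+1) * lambert i.+1)) hL => [N i|i].
  by apply: sdvdMl; apply: (sdvdW (leqnSn i)); apply: sdvd_lambert.
rewrite (_ : C ^+ 2 * _ = (-1) ^+ i.+1 * C * C * lambert i.+1); last by ring.
apply: scvgM (scvg_cst _); apply: scvgM.
  apply: scvgMl; apply: (@scvg_sub (fun N => N + i.+1)%N 0) scvg_qpoch_quot.
  by move=> n; lia.
apply: (@scvg_sub (fun N => N - i.+1)%N i.+1) scvg_qpoch_quot.
by move=> n; lia.
Qed.

Lemma theta_quotient : qpoch_inf (x * q) * qpoch_inf (y * q) *
  ((qpoch_inf (- q) / qpoch_inf q) ^+ 2 *
    (1 + 2%:R * ssum (fun i => (-1) ^+ i.+1 * lambert i.+1))) =
  qpoch_inf (- (x * q)) * qpoch_inf (- (y * q)).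
Proof.
apply: (scvg_unique (scvgM (scvgM (scvg_qpoch _) (scvg_qpoch _)) scvg_theta_pf)).
apply: scvg_ext (scvgM (scvg_qpoch _) (scvg_qpoch _)) => N.
by rewrite theta_pf_prod.
Qed.

End ThetaQuotient.

(** * Specialization to x = z, y = 1/z and c = d = -q *)

Lemma prod_qpochN1 n : \prod_(k < n) (q ^+ (2 * k + 1) + q * q ^+ k) =
  qpoch (-1) n * q ^+ (n * n.+1)./2 :> series K.
Proof.
elim: n => [|n IH]; first by rewrite big_ord0 qpoch0 mul1r.
have -> : ((n.+1 * n.+2)./2 = (n * n.+1)./2 + n.+1)%N.
  by rewrite -!divn2; lia.
(* Each factor is q^(k+1) (1 + q^k); the powers of [q] collect to the triangular exponent. *)
rewrite big_ord_recr IH qpochSr /=.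
by rewrite mul2n -addnn !exprD expr1 exprS; ring.
Qed.

Section Specialization.
Variable z : K.
Hypothesis z_neq0 : z != 0.
Local Notation x := (sC z).
Local Notation y := (sC z^-1).
Local Notation D := (qpoch_inf (x * q) * qpoch_inf (y * q)).

Lemma sCV : x * y = 1.
Proof. by rewrite -rmorphM /= mulfV // rmorph1. Qed.

Lemma Sbar1E : 2%:R * (D * (sC ((1 - z) * (1 - z^-1)) * Sbar1 z)) =
  ssum (heine_term x y (- q)) - ssum (gauss_term x y (- q)).
Proof.
have hN : sdvd 1 (- q) by apply/sdvdN/sdvd_q.
have hu (a : series K) n : qpoch_inf (a * q ^+ n.+1) \is a GRing.unit.
  by apply/qpoch_inf_unit/sdvdMl/(@sdvdW n.+1)/sdvd_qX.
(* Indices are off by one: after clearing denominators [F n] matches the Heine term of index [n.+1],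
   so even [n] gives the odd terms. *)
pose F n := q ^+ n.+1 * qpoch_inf (- q ^+ n.+2) * qpoch_inf (q ^+ n.+2)
  / (qpoch_inf (x * q ^+ n.+1) * qpoch_inf (y * q ^+ n.+1)).
have -> : Sbar1 z = ssum (fun n => F (2 * n)%N).
  rewrite /Sbar1; congr ssum; apply: funext => n.
  rewrite !sscaleE !spowE addn1 addn2 sdivE //.
  by rewrite unitrMl; apply: hu.
have hF : has_ssum (fun n => F (2 * n)%N) (ssum (fun n => F (2 * n)%N)).
  apply: has_ssum_ssum => n; rewrite /F -!mulrA; apply: sdvdMr.
  by apply: (@sdvdW (2 * n).+1); [lia | apply: sdvd_qX].
(* As xy = 1, the lower parameter dxy is again -q, and the Gauss term differs from the Heine term
   only by the sign from (-q)^n. *)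
have hG : has_ssum (fun n => (-1) ^+ n * heine_term x y (- q) n) (ssum (gauss_term x y (- q))).
  apply: eq_has_ssum (has_ssum_gauss x y hN) => n.
  rewrite /gauss_term /heine_term (_ : - q * x * y = - q);
    last by rewrite -mulrA sCV mulr1.
  by rewrite [(- q) ^+ n]exprNn; ring.
have h1 := has_ssum_odd (has_ssum_heine x y (- q)) hG.
have h2 := has_ssumMl 2%:R (has_ssumMl D (has_ssumMl (sC ((1 - z) * (1 - z^-1))) hF)).
apply: has_ssum_unique h2 _; apply: eq_has_ssum h1 => n; congr (_ * _).
rewrite addn1; move: (2 * n)%N => m.
rewrite /heine_term /F !(qpochS _ m) (qpoch_inf_split (x * q) m) (qpoch_inf_split (y * q) m).
rewrite -!mulrA -!exprS mulNr -exprS rmorphM !rmorphB rmorph1 /=.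
set X := qpoch_inf (x * _); set Y := qpoch_inf (y * _).
transitivity ((1 - x) * (1 - y) * q ^+ m.+1 * qpoch (x * q) m * qpoch (y * q) m
  * qpoch_inf (q ^+ m.+2) * qpoch_inf (- q ^+ m.+2) * (X * Y / (X * Y))); last by ring.
by rewrite mulrV ?unitrMl ?hu //; ring.
Qed.

(** [heine_transform] at c = -q: dividing its infinite products by [D] leaves the finite
    denominators of the rank generating function. *)
Lemma Nbar_gfE : D * Nbar_gf z = ssum (heine_term x y (- q)).
Proof.
have hu (a : series K) n : qpoch (a * q) n \is a GRing.unit.
  by apply/qpoch_unit/sdvdMl/sdvd_q.
have hN : sdvd 1 (- q) by apply/sdvdN/sdvd_q.
pose F n := qpoch (-1) n * q ^+ (n * n.+1)./2 / (qpoch (x * q) n * qpoch (y * q) n).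
have -> : Nbar_gf z = ssum F.
  rewrite /Nbar_gf; congr ssum; apply: funext => n.
  rewrite !sscaleE !spowE sdivE ?unitrMl ?hu // /F.
  by rewrite rmorphN1.
have hF : has_ssum F (ssum F).
  apply: has_ssum_ssum => n; rewrite /F; apply/sdvdMr/sdvdMl.
  apply: (@sdvdW (n * n.+1)./2); last exact: sdvd_qX.
  by case: n => [|n] //; rewrite -divn2 leq_divRL // leq_mul2l.
apply: has_ssum_unique (has_ssumMl D hF) _.
apply: eq_has_ssum (heine_transform x y hN) => n.
have -> : \prod_(k < n) (x * y * q ^+ (2 * k + 1) - - q * q ^+ k)
    = qpoch (-1) n * q ^+ (n * n.+1)./2.
  by rewrite -prod_qpochN1; apply: eq_bigr => k _; rewrite sCV; ring.
rewrite /F (qpoch_inf_split (x * q) n) (qpoch_inf_split (y * q) n).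
rewrite -!(mulrA _ q) -!exprS.
set X := qpoch (x * q) n; set Y := qpoch (y * q) n; set W := qpoch (-1) n * _.
transitivity (W * qpoch_inf (x * q ^+ n.+1) * qpoch_inf (y * q ^+ n.+1)
  * (X * Y / (X * Y))); last by ring.
by rewrite mulrV ?unitrMl ?hu // mulr1.
Qed.

(** The q-Gauss sum produces the numerator of the theta quotient; substituting its Lambert expansion
    leaves a common factor (-q)_oo to cancel. *)
Lemma gauss_lambert : ssum (gauss_term x y (- q)) =
  D * (qpoch_inf (- q) / qpoch_inf q
       * (1 + 2%:R * ssum (fun i => (-1) ^+ i.+1 * lambert x y i.+1))).
Proof.
have hN : sdvd 1 (- q) by apply/sdvdN/sdvd_q.
apply: (mulrI (qpoch_inf_unit hN)); rewrite gauss_sum //.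
rewrite !mulNr (mulrC q x) (mulrC q y) -(theta_quotient sCV).
set L := 1 + _; set P := qpoch_inf (- q); set Q := qpoch_inf q.
have hQ : Q \is a GRing.unit by apply/qpoch_inf_unit/sdvd_q.
transitivity (D * P * P / Q * L * (Q / Q)); first by ring.
by rewrite mulrV //; ring.
Qed.

End Specialization.

End SeriesRing.

(** * Assembling the identity *)

Theorem theorem2p4 (K : fieldType) (z : K) (hz : z != 0) (h2 : (2%:R : K) != 0) :
  sscale ((1 - z) * (1 - z^-1)) (Sbar1 z) =
  ssub (sscale (2%:R)^-1 (Nbar_gf z))
       (smul (sdiv (qpoch_inf (sopp (sX K))) (qpoch_inf (sX K)))
             (sadd (sC (2%:R)^-1)
                   (ssum (fun k =>
                      let n := k.+1 in
                      sdiv (sscale ((1 - z) * (1 - z^-1) * (-1) ^+ n) (spow (sX K) n))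
                           (smul (ssub (sC 1) (sscale z (spow (sX K) n)))
                                 (ssub (sC 1) (sscale z^-1 (spow (sX K) n)))))))).
Proof.
set S := ssum _.
have SE : S = ssum (fun i => (-1) ^+ i.+1 * lambert (sC z) (sC z^-1) i.+1).
  congr ssum; apply: funext => i; cbv beta zeta.
  rewrite !sscaleE !spowE sdivE; last exact: lambert_den_unit.
  rewrite /lambert !rmorphM !rmorphB rmorph1 rmorphXn rmorphN1 /=.
  by rewrite [in LHS](mulrC _ ((-1) ^+ i.+1)) -!mulrA.
rewrite sdivE; last exact/qpoch_inf_unit/sdvd_q.
rewrite !sscaleE.
rewrite -[ssub _ _]/(sC 2%:R^-1 * Nbar_gf z -
  qpoch_inf (- sX K) / qpoch_inf (sX K) * (sC 2%:R^-1 + S)).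
set D := qpoch_inf (sC z * sX K) * qpoch_inf (sC z^-1 * sX K).
have hD : D \is a GRing.unit.
  by rewrite unitrMl; apply/qpoch_inf_unit/sdvdMl/sdvd_q.
have half : 2%:R * sC 2%:R^-1 = 1 :> series K.
  by rewrite -(rmorph_nat (@sC K)) -rmorphM mulfV // rmorph1.
have h2u : (2%:R : series K) \is a GRing.unit.
  by rewrite -(rmorph_nat (@sC K)) sunitE.
(* Multiplication by the unit 2D turns the left side into the Heine sum minus the Gauss sum, both
   already evaluated. *)
apply: (mulrI h2u); apply: (mulrI hD); rewrite [LHS]mulrCA Sbar1E //.
rewrite -Nbar_gfE // gauss_lambert // -/D SE; set C := _ / _; set L := ssum _.
transitivity (D * ((2%:R * sC 2%:R^-1) * Nbar_gf z)
  - D * (C * (2%:R * sC 2%:R^-1 + 2%:R * L))); last by ring.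
by rewrite half mul1r.
Qed.
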